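(* Consider the routing protocol described in the context, in the case where every filtering list is empty, i.e. $\mathcal{D}(v)=\emptyset$ for all $v\in V$. Then for every network and every initial configuration there is a choice of four permutations $\pi_1,\pi_2,\pi_3,\pi_4$ of $V\setminus\{r\}$ such that, in four rounds, every packet reaches the sink $r$ (regardless of how packets stuck on cycles are repositioned). In particular this holds even when the network admits no equilibrium.
   Context: A network is a directed graph $G=(V,A)$ on $n$ nodes with a sink node $r$ that has no outgoing arc, such that every node has a directed path to $r$ in $G$. Each node $v\neq r$ has a strict ranking of its out-neighbours (next-hop preferences) and a filtering list $\mathcal{D}(v)\subseteq V$. At any time each node $v\ne r$ has a routing path $\mathcal{P}(v)$, which is either $\emptyset$ or a directed $v,r$-path, and selects at most one outgoing arc; the selected arcs form the routing graph. A node $w$ is clear if $\mathcal{P}(w)\neq\emptyset$. A node $w$ is valid for $v$ if $(v,w)\in A$, $w$ is clear, and $\mathcal{P}(w)$ contains no node of $\mathcal{D}(v)$; the best valid choice of $v$ is its highest-ranked valid out-neighbour. Activating $v$: if $v$ has a valid choice, $v$ selects the arc $(v,w)$ to its best valid choice $w$ and sets $\mathcal{P}(v)$ to $v$ followed by $\mathcal{P}(w)$ (using the current value of $\mathcal{P}(w)$); otherwise $v$ sets $\mathcal{P}(v):=\emptyset$ and selects no arc. Protocol: start from an arbitrary initial routing graph and arbitrary initial routing paths; initially every node generates one packet. In each round $t=1,2,\dots$, a permutation $\pi_t$ of $V\setminus\{r\}$ is chosen (so each node is activated exactly once per round); (control plane) the nodes are activated one at a time in the order $\pi_t$, producing routing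 graph $\mathcal{R}_t$; (forwarding plane) every packet is forwarded along arcs of $\mathcal{R}_t$ (a packet at $v$ moves to the head of $v$'s selected arc) until it reaches $r$ or has moved $n$ hops; (route verification) every node $v$ sets $\mathcal{P}(v)$ to its $v,r$-path in $\mathcal{R}_t$ if one exists and to $\emptyset$ otherwise. A packet stuck on a cycle may be placed by an adversary at any node of that cycle at the start of the next round. A packet routes once it reaches $r$. *)

(* Defs.v *)
From mathcomp Require Import all_boot.

Set Implicit Arguments.
Unset Strict Implicit.
Unset Printing Implicit Defensive.

(* Digraphs are simple: no parallel arcs and no loops.  The ranking of the
   out-neighbours of v is the duplicate-free list [pref v], best first. *)
Record network := Network {
  node :> finType;
  arc : rel node;
  sink : node;
  pref : node -> seq node;
  filtering_list : node -> {set node};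
  arc_irr : irreflexive arc;
  sink_no_out : forall w, ~~ arc sink w;
  sink_reachable : forall v, connect arc v sink;
  pref_uniq : forall v, v != sink -> uniq (pref v);
  pref_arc : forall v, v != sink -> pref v =i arc v
}.

Section Protocol.
Variable N : network.
Implicit Types (u v w : N) (p s : seq N).

(* p lists all the nodes, v and the sink included, of a (simple) directed path
   from v to the sink in the digraph e. *)
Definition sink_path (e : rel N) v p : Prop :=
  exists q, [/\ p = v :: q, path e v q, last v q = sink N & uniq p].

(* [route v] is P(v), with [::] for the empty routing path.  In the middle of a
   control plane phase it may be a walk with repeated nodes, as it is obtained
   by prepending v to a possibly outdated P(w). *)
Record config := Config {
  sel : {ffun N -> option N};
  route : {ffun N -> seq N}
}.

Implicit Types c : config.

(* The sink always has its trivial path, so that it is always clear. *)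
Definition initial_config c : Prop :=
  [/\ forall v w, sel c v = Some w -> arc v w,
      route c (sink N) = [:: sink N] &
      forall v, v != sink N ->
        route c v = [::] \/ sink_path (@arc N) v (route c v)].

Definition clear c w : bool := route c w != [::].

Definition valid c v w : bool :=
  [&& arc v w, clear c w & ~~ has (mem (filtering_list v)) (route c w)].

Definition best_valid_choice c v : option N :=
  ohead [seq w <- pref v | valid c v w].

Definition activate c v : config :=
  let b := best_valid_choice c v in
  let p := if b is Some w then v :: route c w else [::] in
  Config [ffun u => if u == v then b else sel c u]
         [ffun u => if u == v then p else route c u].

Definition control_plane c s : config := foldl activate c s.

Definition activation_order s : Prop :=
  perm_eq s (enum (predC1 (sink N))).

Definition sel_arc c : rel N := fun v w => sel c v == Some w.

(* The sink never selects an arc, so a packet that reaches it stays there; a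
   packet at any other node without a selected arc does not move either. *)
Definition hop c v : N := odflt v (sel c v).

Definition forward c v : N := iter #|N| (hop c) v.

(* The walk of #|N| nodes from v along selected arcs, cut at the sink; it meets
   the sink if and only if the routing graph has a path from v to the sink, and then it is that path (see
   [verified_path_complete] and [verified_path_sound]). *)
Definition verified_path c v : seq N :=
  let t := traject (hop c) v #|N| in
  if sink N \in t then take (index (sink N) t).+1 t else [::].

Definition verify c : config := Config (sel c) [ffun v => verified_path c v].

(* The selected arcs of the result form the routing graph of the round. *)
Definition round c s : config := verify (control_plane c s).

(* Starting the forwarding phase at u with the routing graph of c, a packet may
   start the next phase at v.  A cycle is listed without repetition. *)
Definition packet_move c u v : Prop :=
  v = forward c u \/
  exists p, [/\ ucycle (sel_arc c) p, forward c u \in p & v \in p].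

(* A packet at u reaches the sink during the rounds with activation orders
   [orders] started from c, whatever the adversary does. *)
Fixpoint reaches_sink c (orders : seq (seq N)) u : Prop :=
  if orders is s :: orders' then
    forall v, packet_move (round c s) u v -> reaches_sink (round c s) orders' v
  else u = sink N.

Lemma verified_path_complete c v p :
  sink_path (sel_arc c) v p -> verified_path c v = p.
Proof.
move=> [q [-> pq lq uq]].
have hopE x y : sel_arc c x y -> hop c x = y by rewrite /hop => /eqP ->.
have tq : v :: q = traject (hop c) v (size q).+1.
  rewrite /=; congr cons; elim: q v pq {lq uq} => //= w q IH v /andP[/hopE <- pq].
  by rewrite -IH.
have sq : (size q).+1 <= #|N| by rewrite -[_.+1]/(size (v :: q)) -(card_uniqP uq) max_card.
have mq : sink N \in v :: q by rewrite -lq mem_last.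
have tt : take (size q).+1 (traject (hop c) v #|N|) = v :: q.
  by rewrite take_traject.
have iq : index (sink N) (traject (hop c) v #|N|) = size q.
  rewrite -(cat_take_drop (size q).+1 (traject _ _ _)) tt index_cat mq.
  by rewrite -lq index_last.
by rewrite /verified_path (mem_take (n0 := (size q).+1)) ?tt // iq tt.
Qed.

Lemma verified_path_sound c v : verified_path c v <> [::] ->
  sink_path (sel_arc c) v (verified_path c v).
Proof.
rewrite /verified_path; case: ifP => // st _.
set f := hop c; set t := traject f v #|N| in st *; set i := index _ t.
have ltin : i < #|N| by rewrite -[#|N|](size_traject f v) index_mem.
have fi : iter i f v = sink N.
  by rewrite -[LHS](nth_traject f ltin) nth_index.
have tE : take i.+1 t = traject f v i.+1 by rewrite take_traject.
have ut : uniq (traject f v i.+1).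
  rewrite looping_uniq; apply/negP=> /trajectP[j ji]; rewrite fi => sj.
  have : nth v t j = sink N by rewrite nth_traject // (ltn_trans ji).
  by move=> tj; have := before_find v ji; rewrite /= tj eqxx.
rewrite tE; exists (traject f (f v) i); split => //; last first.
  by rewrite last_traject.
have fp : fpath f v (traject f (f v) i) by apply/fpathP; exists i.
apply/(pathP v) => k; rewrite size_traject => ki.
have /(pathP v)/(_ k) := fp; rewrite size_traject => /(_ ki) /eqP <-.
rewrite /sel_arc /f /hop; set x := nth v _ k.
case Ex : (sel c x) => //=.
have xE : x = iter k f v by rewrite /x -trajectS nth_traject // ltnW.
have fx : f x = x by rewrite /f /hop Ex.
have := nth_uniq v _ _ ut; move/(_ k k.+1); rewrite size_traject.
rewrite ltnS (ltnW ki) ltnS ki => /(_ isT isT).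
rewrite !nth_traject ?ltnS ?(ltnW ki) //= -xE fx eqxx.
by rewrite -[RHS]/(k == k.+1) eqn_leq ltnn andbF.
Qed.

End Protocol.

(* Main.v *)
(** Without filtering, the outcome of a round depends only on the set S of
    clear nodes at its start and on the activation order.  Let fav v be the
    favourite out-neighbour of v, and F the set of the nodes whose fav-walk
    reaches the sink r.  We only use orders that activate the nodes outside S
    first, each when it has a clear out-neighbour; then every node becomes
    clear, and the nodes of S, activated last, all select their favourite.

    A trap is a set D of nodes avoiding r, with an order q of D \ S for which
    all nodes of D select inside D.  Take D of maximal size and activate q
    first.  The nodes that fail to reach r at the end of the round form a trap
    again, hence are exactly those of D; also, by maximality, the complement
    of D is closed under fav, and the nodes activated after q prefer what they
    select to every node of D.

    Do this in rounds 1 and 2 (activating F \ S before anything else in round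
    1, so that F is clear from then on).  As the clear set S_2 after round 1 is
    closed under fav, its nodes that still reach r in round 2 are those of F,
    so the clear set after round 2 is F together with the nodes p activated
    after q.  It is closed under fav, so in round 3 all packets end up in it,
    while of its nodes only those of F remain clear.  In round 4, activate p
    first, in the same order as in round 2: only F and nodes of D are clear, the
    latter being less attractive, so p selects as in round 2 and every node of F
    and p, thus every packet, reaches r. *)

Require Import Defs.
From mathcomp Require Import all_boot.
Set Implicit Arguments.
Unset Strict Implicit.
Unset Printing Implicit Defensive.

(** * Best choices, favourites and activation orders *)

Section Selection.
Variable N : network.
Implicit Types (X Y D S : {set N}) (p q s : seq N) (u v w : N).
Local Notation r := (sink N).

Definition best X v : option N := ohead [seq w <- pref v | w \in X].

(** The loop at the sink makes [fav] total, so that fav-walks are handled by [fconnect]; the default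
    [v] never occurs, as every node but the sink has an out-neighbour. *)
Definition fav v : N := if v == r then r else odflt v (best setT v).

Definition before p v : {set N} := [set:: take (index v p) p].

(* The selection of v when the nodes are activated in the order p, X is the
   initial set of clear nodes, and all nodes of p before v become clear. *)
Definition chosen X p v : option N := best (X :|: before p v) v.

Definition live S s : Prop := forall y, y \in s -> chosen S s y != None.

Definition fav_reach : {set N} := [set v | fconnect fav v r].

Lemma best_mem X v w : best X v = Some w -> w \in X.
Proof.
rewrite /best; have := filter_all (fun w => w \in X) (pref v).
by case: filter => //= a l /andP[aX _] [<-].
Qed.

Lemma best_sub X Y v w :
  best X v = Some w -> Y \subset X -> w \in Y -> best Y v = Some w.
Proof.
rewrite /best => bX /subsetP sYX wY; elim: (pref v) bX => //= a l IH.
case: ifP => [_ [->]|aX]; first by rewrite wY.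
by rewrite (contraFF (sYX a)).
Qed.

Lemma best_arc X v w : v != r -> Defs.arc v w -> w \in X -> best X v != None.
Proof.
move=> vr avw wX; rewrite /best.
have : w \in [seq w <- pref v | w \in X] by rewrite mem_filter wX pref_arc.
by case: filter.
Qed.

Lemma ex_arc v : v != r -> exists w, Defs.arc v w.
Proof.
move=> vr; have /connectP[[|w l] /= + ] := sink_reachable v.
  by move=> _ e; rewrite -e eqxx in vr.
by case/andP=> avw _ _; exists w.
Qed.

Lemma best_fav v : v != r -> best setT v = Some (fav v).
Proof.
move=> vr; have [w avw] := ex_arc vr.
rewrite /fav (negbTE vr); have := best_arc vr avw (in_setT w).
by case: best.
Qed.

Lemma best_eq_fav X v : v != r -> fav v \in X -> best X v = Some (fav v).
Proof. by move=> vr; apply: best_sub (best_fav vr) (subsetT _). Qed.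

Lemma fav_sink : fav r = r. Proof. by rewrite /fav eqxx. Qed.

Lemma before_cat_l p q v : v \in p -> before (p ++ q) v = before p v.
Proof.
by move=> vp; rewrite /before index_cat vp take_cat index_mem vp.
Qed.

Lemma before_cat_r p q v :
  v \notin p -> before (p ++ q) v = [set:: p] :|: before q v.
Proof.
move=> vp; rewrite /before index_cat (negbTE vp) take_cat ltnNge leq_addr /= addKn.
by apply/setP=> x; rewrite !inE mem_cat.
Qed.

Lemma chosen_cat_l X p q v : v \in p -> chosen X (p ++ q) v = chosen X p v.
Proof. by move=> vp; rewrite /chosen before_cat_l. Qed.

Lemma chosen_cat_r X p q v :
  v \notin p -> chosen X (p ++ q) v = chosen (X :|: [set:: p]) q v.
Proof. by move=> vp; rewrite /chosen before_cat_r // setUA. Qed.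

Lemma before_filter (a : pred N) p v : a v -> v \in p ->
  before (filter a p) v = [set x in before p v | a x].
Proof.
move=> av; elim: p => //= x p IH; rewrite inE.
rewrite /before; case: (eqVneq v x) => [<- _|vx /= /IH E].
  by rewrite av /= !eqxx; apply/setP => y; rewrite !inE.
rewrite eq_sym (negbTE vx); case: ifP => ax /=.
  rewrite eq_sym (negbTE vx); apply/setP => y; move/setP/(_ y): E; rewrite !inE => ->.
  by case: eqVneq => // ->; rewrite ax.
apply/setP => y; move/setP/(_ y): E; rewrite !inE => ->.
by case: eqVneq => // ->; rewrite ax !andbF.
Qed.

(** Backward search from [X]: while some node outside [X] reaches the sink, the first arc of its
    path that enters [X] gives the next node of [p]. Used with [arc] for live orders and with [fav]
    for [fav_reach]. *)
Lemma search_order (e : rel N) X : r \in X ->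
  exists p, [/\ uniq p, p =i [set v | connect e v r] :\: X &
    forall y, y \in p -> exists2 w, e y w & w \in X :|: before p y].
Proof.
have [n] := ubnP #|[set v | connect e v r] :\: X|.
elim: n X => // n IH X le_n rX.
have [E|[v]] := set_0Vmem ([set v | connect e v r] :\: X).
  by exists [::]; split=> // x; rewrite E inE.
rewrite !inE => /andP[vX /connectP[l el lr]].
have {v l vX el lr} [y [w [yX wX eyw cy]]] :
  exists y w, [/\ y \notin X, w \in X, e y w & connect e y r].
  elim: l v vX el lr => [|a l IHl] v vX /=; first by move=> _ E; rewrite -E rX in vX.
  case/andP=> eva el lr; have [aX|aX] := boolP (a \in X); last exact: IHl el lr.
  exists v, a; split=> //; apply/connectP; exists (a :: l) => //=.
  by rewrite eva.
have [|| p [up memp stepp]] := IH (y |: X); last 1 first.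
- exists (y :: p); split=> [|x|z]; rewrite /= ?inE.
  + by rewrite up memp !inE eqxx.
  + by rewrite memp !inE; case: eqVneq => // ->; rewrite yX cy.
  case: eqVneq => [-> _|zy /= /stepp[w' ezw' w'X]].
    by exists w => //; rewrite inE wX.
  exists w' => //; move: w'X; rewrite /before /= (eq_sym y) (negbTE zy) /= !inE.
  by rewrite orbCA orbA.
- apply: leq_trans (_ : #|[set v | connect e v r] :\: X| <= n) => //.
  apply: proper_card; rewrite properE; apply/andP; split.
    by apply: setDS; apply: subsetUr.
  by apply/subsetPn; exists y; rewrite !inE ?yX ?eqxx.
by rewrite inE rX orbT.
Qed.

Lemma live_order S : r \in S -> exists p, [/\ uniq p, p =i ~: S & live S p].
Proof.
move=> rS; have [p [up memp stepp]] := search_order (@Defs.arc N) rS.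
have memp' : p =i ~: S by move=> v; rewrite memp !inE sink_reachable andbT.
exists p; split=> // y yp; have [w ayw wS] := stepp y yp.
apply: best_arc ayw wS; apply: contraTneq yp => ->.
by rewrite memp' inE rS.
Qed.

Lemma fconnect_closed (h : N -> N) (A : {set N}) u v :
  (forall x, x \in A -> h x \in A) -> u \in A -> fconnect h u v -> v \in A.
Proof.
move=> clA Au /iter_findex <-; elim: findex => //= k; exact: clA.
Qed.

Lemma fconnect_in_eq (h h' : N -> N) (A : {set N}) u v :
    (forall x, x \in A -> h' x \in A) -> {in A, h =1 h'} ->
  u \in A -> fconnect h u v = fconnect h' u v.
Proof.
move=> clA hh' uA; have E k : iter k h u = iter k h' u.
  suff: iter k h u = iter k h' u /\ iter k h' u \in A by case.
  by elim: k => //= k [-> iA]; rewrite hh' // clA.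
by apply/idP/idP => /iter_findex <-; [rewrite E|rewrite -E]; apply: fconnect_iter.
Qed.

(** Each step leads into [A] or to a strictly earlier entry of [p], so induction on the index
    applies. *)
Lemma before_reach (h : N -> N) (A : {set N}) p :
    (forall y, y \in p -> h y \in A :|: before p y) ->
  forall y, y \in p -> exists2 x, x \in A & fconnect h y x.
Proof.
move=> step y; have [n] := ubnP (index y p); elim: n y => // n IH y le_n yp.
have := step y yp; rewrite inE => /orP[hA|]; first by exists (h y) => //; apply: fconnect1.
rewrite inE => hb; have hp := mem_take hb.
have lt : index (h y) p < index y p by rewrite index_ltn.
have [x xA hx] := IH (h y) (leq_trans lt le_n) hp.
by exists x => //; apply: connect_trans hx; apply: fconnect1.
Qed.


(** * Traps of maximal size *)

Definition trap S D q : bool :=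
  [&& r \notin D, perm_eq q (enum (D :\: S)),
      [forall (v | v \in S :&: D), fav v \in D]
    & all (fun y => oapp (mem D) false (chosen S q y)) q].

Definition max_trap S D q : Prop :=
  trap S D q /\ forall D' q', trap S D' q' -> #|D'| <= #|D|.

Lemma trapP S D q : reflect
  [/\ r \notin D, uniq q, q =i D :\: S, forall v, v \in S -> v \in D -> fav v \in D
    & forall y, y \in q -> exists2 w, chosen S q y = Some w & w \in D]
  (trap S D q).
Proof.
apply: (iffP and4P) => [[rD qD /forall_inP cl /allP ch]|[rD uq qD cl ch]]; split=> //.
- by rewrite (perm_uniq qD) enum_uniq.
- by move=> v; rewrite (perm_mem qD) mem_enum.
- by move=> s sS sD; apply: cl; rewrite inE sS.
- by move=> y /ch; case: chosen => //= w wD; exists w.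
- by apply: uniq_perm; rewrite ?enum_uniq // => v; rewrite qD mem_enum.
- by apply/forall_inP => s /setIP[sS sD]; apply: cl.
by apply/allP => y /ch[w -> wD].
Qed.

Lemma max_trap_exists S : exists D q, max_trap S D q.
Proof.
(* Listing the candidate orders as permutations makes [ok] boolean, so a largest [D] can be picked;
   the empty trap shows that there is one. *)
pose ok D := has (trap S D) (permutations (enum (D :\: S))).
have okP D : reflect (exists q, trap S D q) (ok D).
  apply: (iffP hasP) => [[q _]|[q tq]]; exists q => //.
  by rewrite mem_permutations; case/and4P: tq.
have ok0 : ok set0.
  apply/okP; exists [::]; apply/trapP; split=> //; first by rewrite inE.
    by move=> v; rewrite !inE andbF.
  by move=> s _; rewrite inE.
case: (arg_maxnP (fun D => #|D|) ok0) => D /okP[q tq] maxD.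
by exists D, q; split=> // D' q' tq'; apply: maxD; apply/okP; exists q'.
Qed.

Lemma max_trap_notin S D q q' v : max_trap S D q -> trap S (v |: D) q' -> v \in D.
Proof.
case=> _ maxD /maxD; apply: contraTT => vD.
by rewrite cardsU1 vD -ltnNge.
Qed.

(** Otherwise [v] could be appended to [q], at a moment when exactly [S :|: D] is clear, giving a
    larger trap. *)
Lemma max_trap_best S D q v w : r \in S -> max_trap S D q ->
  v \notin D -> v \notin S -> best (S :|: D) v = Some w -> w \notin D.
Proof.
move=> rS mtD vD vS bw; apply: contraNN (vD) => wD.
have [/trapP[rD uq qD cl ch] _] := mtD.
have vq : v \notin q by rewrite qD inE vS.
apply: (max_trap_notin (q' := rcons q v)) (mtD) _; apply/trapP; split.
- by rewrite !inE negb_or rD andbT; apply: contraNneq vS => <-.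
- by rewrite rcons_uniq vq.
- by move=> x; rewrite mem_rcons inE qD !inE; case: eqVneq => // ->; rewrite vS.
- move=> s sS; rewrite !inE => /orP[/eqP sv|sD]; first by rewrite -sv sS in vS.
  by rewrite cl ?orbT.
move=> y; rewrite mem_rcons inE -cats1 => /orP[/eqP->|yq].
  rewrite chosen_cat_r // /chosen /before /= eqxx /=; exists w; last by rewrite !inE wD orbT.
  rewrite -bw; congr best; apply/setP => x.
  by rewrite !inE qD !inE orbF; case: (x \in S).
rewrite chosen_cat_l //; have [x -> xD] := ch y yq.
by exists x => //; rewrite !inE xD orbT.
Qed.

(** For [v] in [S], the same [q] would serve [v |: D]; otherwise a favourite in [D] would be the
    best choice in [S :|: D]. *)
Lemma max_trap_fav S D q v : r \in S -> max_trap S D q ->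
  v \notin D -> fav v \notin D.
Proof.
move=> rS mtD vD; have [/trapP[rD uq qD cl ch] _] := mtD.
have [->|vr] := eqVneq v r; first by rewrite fav_sink.
have [vS|vS] := boolP (v \in S); last first.
  apply/negP => fD; have := max_trap_best rS mtD vD vS.
  by rewrite (best_eq_fav vr (X := S :|: D)) ?inE ?fD ?orbT // => /(_ _ erefl); rewrite fD.
apply: contraNN (vD) => fD.
apply: (max_trap_notin (q' := q)) (mtD) _; apply/trapP; split=> //.
- by rewrite !inE negb_or rD andbT eq_sym.
- by move=> x; rewrite qD !inE; case: eqVneq => // ->; rewrite vS.
- move=> s sS; rewrite !inE => /orP[/eqP->|sD]; first by rewrite fD orbT.
  by rewrite cl ?orbT.
by move=> y /ch[w -> wD]; exists w => //; rewrite !inE wD orbT.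
Qed.

Lemma max_trap_escape S D q p (h : N -> N) : max_trap S D q ->
    uniq (q ++ p) -> q ++ p =i ~: S -> h r = r -> {in S, h =1 fav} ->
    (forall y, y \in q ++ p -> chosen S (q ++ p) y = Some (h y)) ->
  forall v, fconnect h v r = (v \notin D).
Proof.
move=> [/trapP[rD uq qD cl ch] maxD] uqp qpS hr hS hqp.
(* The nodes of D' select inside D', so they make the same selections when the
   nodes outside D' are left out of the order: D' is a trap containing D. *)
pose D' := [set v | ~~ fconnect h v r].
have DD' : D \subset D'.
  apply/subsetP => v vD; rewrite inE; apply: contraNN rD.
  apply: fconnect_closed vD => x xD; have [xS|xS] := boolP (x \in S).
    by rewrite hS ?cl.
  have xq : x \in q by rewrite qD inE xS.
  have [w cw wD] := ch x xq; have := hqp x; rewrite mem_cat xq chosen_cat_l // cw.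
  by move=> /(_ isT)[<-].
have clD' x : x \in D' -> h x \in D'.
  by rewrite !inE; apply: contraNN => /(connect_trans (fconnect1 h x)).
have tD' : trap S D' (filter (mem D') (q ++ p)).
  apply/trapP; split.
  - by rewrite inE connect0.
  - by rewrite filter_uniq.
  - by move=> x; rewrite mem_filter qpS !inE andbC.
  - by move=> s sS sD; rewrite -hS // clD'.
  move=> y; rewrite mem_filter => /andP[yD' yqp]; exists (h y); last exact: clD'.
  have cy := hqp y yqp; have hb := best_mem cy.
  apply: best_sub cy _ _; rewrite before_filter //.
    by apply: setUS; apply/subsetP => x; rewrite inE => /andP[].
  move: hb (clD' y yD'); rewrite !inE => /orP[->//|hb hD'].
  by rewrite hb hD' orbT.
have /eqP/setP E : D == D' by rewrite eqEcard DD' (maxD _ _ tD').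
by move=> v; rewrite E inE negbK.
Qed.

(** * Activation orders for the single rounds *)

Definition hop_of S s v : N := if v == r then r else odflt v (chosen S s v).

Definition reached S s : {set N} := [set v | fconnect (hop_of S s) v r].

Definition full_order S p : seq N := p ++ enum (S :\ r).

Lemma sink_fav_reach : r \in fav_reach.
Proof. by rewrite inE connect0. Qed.

Lemma fav_reach_closed v : v \in fav_reach -> fav v \in fav_reach.
Proof.
rewrite !inE => /iter_findex; case: findex => [/= ->|k <-]; last first.
  by rewrite iterSr fconnect_iter.
by rewrite fav_sink connect0.
Qed.

Lemma hop_of_sink S s : hop_of S s r = r. Proof. by rewrite /hop_of eqxx. Qed.

Lemma chosen_full_order S p v :
  p =i ~: S -> v \in S -> v != r -> chosen S (full_order S p) v = Some (fav v).
Proof.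
move=> pS vS vr; have vp : v \notin p by rewrite pS inE vS.
rewrite chosen_cat_r //; apply: best_eq_fav => //.
by rewrite !inE pS inE orbN.
Qed.

Lemma hop_of_full_order S p :
  p =i ~: S -> {in S, hop_of S (full_order S p) =1 fav}.
Proof.
move=> pS v vS; rewrite /hop_of; case: eqVneq => [->|vr]; first by rewrite fav_sink.
by rewrite chosen_full_order.
Qed.

Lemma chosen_hop_of S p y : r \in S -> p =i ~: S -> live S p -> y \in p ->
  chosen S p y = Some (hop_of S (full_order S p) y).
Proof.
move=> rS pS lp yp; rewrite /hop_of chosen_cat_l //.
have -> : (y == r) = false by apply: contraTF yp => /eqP->; rewrite pS inE rS.
by have := lp y yp; case: chosen.
Qed.

Lemma full_order_live S p : p =i ~: S -> live S p -> live S (full_order S p).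
Proof.
move=> pS lp y; rewrite mem_cat => yp; have [yp'|yp'] := boolP (y \in p).
  by rewrite chosen_cat_l ?lp.
move: yp; rewrite (negbTE yp') mem_enum !inE => /andP[yr yS].
by rewrite chosen_full_order.
Qed.

Lemma full_order_activation S p :
  r \in S -> uniq p -> p =i ~: S -> activation_order (full_order S p).
Proof.
move=> rS up pS; apply: uniq_perm.
- rewrite cat_uniq up enum_uniq andbT /=; apply/hasPn => x.
  by rewrite mem_enum pS !inE => /andP[_ ->].
- exact: enum_uniq.
move=> x; rewrite mem_cat pS !mem_enum !inE.
by case: eqVneq => [->|]; rewrite ?rS // orbC orbN.
Qed.

Lemma fav_order S : r \in S ->
  exists p, [/\ uniq p, p =i fav_reach :\: S &
    forall y, y \in p -> chosen S p y = Some (fav y)].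
Proof.
move=> rS; have [p [up memp stepp]] := search_order (frel fav) rS.
exists p; split=> // y yp; have [w /eqP <- fX] := stepp y yp.
apply: best_eq_fav => //; apply: contraTneq yp => ->.
by rewrite memp inE rS.
Qed.

(** Serves rounds 1 and 2. The conditional part assumes what round 1 secures; its [p] is replayed in
    round 4, with [Z] the clear set after round 3. *)
Lemma escape_order S : r \in S -> exists s, [/\ activation_order s, live S s,
  forall v, v \in reached S s -> fav v \in reached S s, fav_reach \subset reached S s &
  (forall v, v \in S -> fav v \in S) -> fav_reach \subset S ->
  exists p, [/\ uniq p, p =i reached S s :\: fav_reach &
    forall Z : {set N}, fav_reach \subset Z -> Z \subset fav_reach :|: ~: reached S s ->
    forall y, y \in p -> exists2 w,
      chosen Z p y = Some w & w \in fav_reach :|: before p y]].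
Proof.
move=> rS; have [p0 [up0 mp0 ch0]] := fav_order rS.
(* The clear set once [p0] is activated; the trap is taken relative to it. *)
pose S1 := S :|: [set:: p0].
have S1E : S1 = S :|: fav_reach.
  by apply/setP => x; rewrite !inE mp0 !inE; case: (x \in S).
have rS1 : r \in S1 by rewrite inE rS.
have [D [q mtD]] := max_trap_exists S1.
have [/trapP[rD uq qD clD chq] maxD] := mtD.
have rSD : r \in S1 :|: D by rewrite inE rS1.
have [p [up mp lp]] := live_order rSD.
have qnp x : x \in q -> x \notin p.
  by rewrite mp qD !inE negbK => /andP[_ ->]; rewrite orbT.
have uqp : uniq (q ++ p).
  by rewrite cat_uniq uq up andbT /=; apply/hasPn => x; apply: contraL => /qnp.
have mqp : q ++ p =i ~: S1.
  move=> x; rewrite mem_cat qD mp !in_setC in_setU in_setD.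
  by case: (x \in D); case: (x \in S1).
have S1q : S1 :|: [set:: q] = S1 :|: D.
  by apply/setP => x; rewrite in_setU inE qD in_setD in_setU; case: (x \in S1).
have lqp : live S1 (q ++ p).
  move=> y; rewrite mem_cat; have [yq _|yq /= yp] := boolP (y \in q).
    by rewrite chosen_cat_l //; have [w -> _] := chq y yq.
  by rewrite chosen_cat_r // S1q lp.
pose P := p0 ++ (q ++ p); pose s := full_order S P.
have mP : P =i ~: S.
  move=> x; rewrite mem_cat mqp mp0 S1E in_setD !in_setC in_setU.
  by case: (x \in S); case: (x \in fav_reach).
have qpnp0 x : x \in q ++ p -> x \notin p0.
  by rewrite mqp in_setC; apply: contraNN => x0; rewrite in_setU inE x0 orbT.
have uP : uniq P.
  by rewrite cat_uniq up0 uqp andbT /=; apply/hasPn => x /qpnp0.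
have chP y : y \in q ++ p -> chosen S P y = chosen S1 (q ++ p) y.
  by move=> /qpnp0; apply: chosen_cat_r.
have lP : live S P.
  move=> y; rewrite mem_cat; have [y0 _|y0 /= yqp] := boolP (y \in p0).
    by rewrite chosen_cat_l ?ch0.
  by rewrite chP ?lqp.
have hP y : y \in P -> chosen S P y = Some (hop_of S s y) by exact: chosen_hop_of.
have hS1 : {in S1, hop_of S s =1 fav}.
  move=> v; rewrite !inE => /orP[|v0]; first exact: hop_of_full_order.
  have vP : v \in P by rewrite mem_cat v0.
  by have := hP v vP; rewrite chosen_cat_l // ch0 // => -[].
have reachE v : (v \in reached S s) = (v \notin D).
  rewrite inE; apply: (max_trap_escape mtD uqp mqp) => [|//|y yqp].
    exact: hop_of_sink.
  by rewrite -chP // hP // mem_cat yqp orbT.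
have FR : fav_reach \subset reached S s.
  apply/subsetP => v vF; rewrite inE.
  rewrite (fconnect_in_eq _ (fun x => @fav_reach_closed x) _ vF); first by rewrite inE in vF.
  by move=> x xF; rewrite hS1 // S1E inE xF orbT.
exists s; split=> //.
- exact: full_order_activation.
- exact: full_order_live.
- by move=> v; rewrite !reachE; apply: max_trap_fav rS1 mtD.
move=> clS FS.
(* As [S] is closed under [fav], the hop-walk from a node of [S] is its fav-walk. *)
have S_reach v : v \in S -> v \in reached S s -> v \in fav_reach.
  move=> vS; rewrite !inE (fconnect_in_eq _ clS (h' := fav) _ vS) //.
  exact: hop_of_full_order.
have S1S : S1 = S by rewrite S1E; apply/setUidPl.
exists p; split=> // [x|Z FZ ZF y yp].
  rewrite mp [in RHS]inE reachE S1S !in_setC !in_setU negb_or andbC.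
  have [xD|xD] := boolP (x \in D); rewrite ?andbF //= !andbT; congr negb.
  by apply/idP/idP => [xS|/(subsetP FS)//]; apply: S_reach; rewrite ?reachE.
have yqp : y \in q ++ p by rewrite mem_cat yp orbT.
have yq : y \notin q by apply: contraL yp; apply: qnp.
have yP : y \in P by rewrite mem_cat yqp orbT.
have cy : chosen (S :|: D) p y = Some (hop_of S s y).
  by rewrite -hP // chP // chosen_cat_r // S1q S1S.
(* [y] reaches the sink, so its hop does too, whereas no node of [D] does. *)
have hyD : hop_of S s y \notin D.
  have yD : y \notin D by move: yp; rewrite mp !inE negb_or => /andP[].
  rewrite -reachE inE; move: yD; rewrite -reachE inE => /iter_findex.
  case: findex => [/= ->|k <-]; first by rewrite hop_of_sink connect0.
  by rewrite iterSr fconnect_iter.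
have hF : hop_of S s y \in fav_reach :|: before p y.
  have := best_mem cy; rewrite in_setU in_setU (negbTE hyD) orbF => /orP[hS|hb].
    by rewrite in_setU S_reach ?reachE.
  by rewrite in_setU hb orbT.
(* Replacing [S :|: D] by [Z] only removes candidates, and not the chosen one, which lies in
   [fav_reach] or earlier in [p]. *)
exists (hop_of S s y) => //; apply: best_sub cy _ _.
  apply: setSU; apply: subset_trans ZF _; apply: setUSS => //.
  by apply/subsetP => x; rewrite inE reachE negbK.
by move: hF; rewrite !(in_setU (hop_of _ _ _)) => /orP[/(subsetP FZ)->//|->]; rewrite orbT.
Qed.


(** For round 3: a node outside [S] selects in [S] or a node activated earlier, so every walk enters
    [S]. *)
Lemma settled_order S : r \in S -> (forall v, v \in S -> fav v \in S) ->
  exists s, [/\ activation_order s, live S s, {in S, hop_of S s =1 fav} &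
    forall u, exists2 x, x \in S & fconnect (hop_of S s) u x].
Proof.
move=> rS clS; have [p [up mp lp]] := live_order rS.
have hS := hop_of_full_order mp; exists (full_order S p); split=> //.
- exact: full_order_activation.
- exact: full_order_live.
move=> u; have [uS|uS] := boolP (u \in S); first by exists u.
apply: (@before_reach _ S p); last by rewrite mp inE.
by move=> y yp; apply: best_mem (chosen_hop_of rS mp lp yp).
Qed.

(** For round 4: walks from [p] go back along [p] until they enter [fav_reach], whose nodes are
    clear and follow their favourites to the sink. *)
Lemma rescue_order S p : uniq p -> [disjoint p & S] -> fav_reach \subset S ->
    (forall y, y \in p -> exists2 w,
      chosen S p y = Some w & w \in fav_reach :|: before p y) ->
  exists s, [/\ activation_order s, live S s
    & {subset fav_reach :|: [set:: p] <= reached S s}].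
Proof.
move=> up pS FS chp; have rS : r \in S := subsetP FS _ sink_fav_reach.
have rSp : r \in S :|: [set:: p] by rewrite inE rS.
have [q [uq mq lq]] := live_order rSp.
have mpq : p ++ q =i ~: S.
  move=> x; rewrite mem_cat mq !inE; have [xp|xp] /= := boolP (x \in p).
    by rewrite (disjointFr pS xp).
  by rewrite orbF.
have upq : uniq (p ++ q).
  rewrite cat_uniq up uq andbT; apply/hasPn => x.
  by rewrite mq !inE negb_or => /andP[].
have lpq : live S (p ++ q).
  move=> y; rewrite mem_cat; have [yp _|yp /= yq] := boolP (y \in p).
    by rewrite chosen_cat_l //; have [w ->] := chp y yp.
  by rewrite chosen_cat_r ?lq.
have hS := hop_of_full_order mpq.
exists (full_order S (p ++ q)); split; [exact: full_order_activation|exact: full_order_live|].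
have FR v : v \in fav_reach -> v \in reached S (full_order S (p ++ q)).
  move=> vF; rewrite inE (fconnect_in_eq _ (fun x => @fav_reach_closed x) _ vF).
    by rewrite inE in vF.
  by move=> x /(subsetP FS); apply: hS.
move=> v; rewrite in_setU => /orP[/FR//|]; rewrite inE => vp.
have [y yp|x xF vx] := @before_reach (hop_of S (full_order S (p ++ q))) fav_reach p _ v vp.
  have [w cw wF] := chp y yp.
  have ypq : y \in p ++ q by rewrite mem_cat yp.
  have := chosen_hop_of rS mpq lpq ypq; rewrite chosen_cat_l // cw => -[<-].
  exact: wF.
by rewrite inE; apply: connect_trans vx _; have := FR x xF; rewrite inE.
Qed.

(** * From rounds of the protocol to selections *)

Implicit Types c : config N.

Definition clear_set c : {set N} := [set v | clear c v].

Definition sink_ok c : Prop := sel c r = None /\ r \in clear_set c.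

Lemma initial_sink_ok c : initial_config c -> sink_ok c.
Proof.
case=> arcs rr _; split; last by rewrite inE /clear rr.
by case E: (sel c r) => [w|//]; have := arcs _ _ E; rewrite (negbTE (sink_no_out w)).
Qed.

Lemma fconnect_traject (h : N -> N) u v :
  fconnect h u v = (v \in traject h u #|N|).
Proof.
apply/idP/trajectP => [uv|[i _ ->]]; last exact: fconnect_iter.
exists (findex h u v); last by rewrite iter_findex.
by apply: leq_trans (findex_max uv) _; apply: max_card.
Qed.

(** The walk meets [A] within [#|N|] hops and then stays there; a cycle through a node of [A] lies
    in [A], so the adversary cannot move the packet out. *)
Lemma packet_move_closed c (A : {set N}) u v :
    (forall x, x \in A -> hop c x \in A) ->
    (exists2 x, x \in A & fconnect (hop c) u x) ->
  packet_move c u v -> v \in A.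
Proof.
move=> clA [x xA ux].
have fA : forward c u \in A.
  move: ux; rewrite fconnect_traject => /trajectP[i lt_i xi].
  rewrite /forward -(subnK (ltnW lt_i)) iterD -xi.
  by apply: fconnect_closed clA xA _; apply: fconnect_iter.
case=> [->//|[p [/andP[cp _] fp vp]]].
apply: fconnect_closed clA fA _; apply: connect_sub (connect_cycle cp fp vp).
by move=> y z /eqP E; apply: connect1; rewrite /= /hop E.
Qed.

Section NoFiltering.
Hypothesis no_filtering : forall v : N, filtering_list v = set0.

Lemma best_valid_choiceE c v : v != r -> best_valid_choice c v = best (clear_set c) v.
Proof.
move=> vr; congr ohead; apply: eq_in_filter => w; rewrite pref_arc // => avw.
rewrite /valid no_filtering inE (_ : Defs.arc v w) //= -[RHS]andbT; congr andb.
by apply/hasPn => x _; rewrite -[mem _ x]/(x \in set0) in_set0.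
Qed.

Lemma clear_set_activate c v : v != r -> best (clear_set c) v != None ->
  clear_set (activate c v) = v |: clear_set c.
Proof.
move=> vr bv; apply/setP => u; rewrite !inE /clear /activate best_valid_choiceE //= ffunE.
by case: (eqVneq u v) => // _; case: best bv.
Qed.

(** Only the emptiness of routing paths matters, so outdated paths do no harm: each activation just
    adds one node to the clear set. *)
Lemma sel_control_plane c s v : uniq s -> r \notin s -> live (clear_set c) s ->
  sel (control_plane c s) v =
    if v \in s then chosen (clear_set c) s v else sel c v.
Proof.
elim: s c => //= y s IH c /andP[ys us]; rewrite inE negb_or eq_sym => /andP[yr rs] ls.
have bestN : best (clear_set c) y != None.
  have := ls y (mem_head y s); rewrite /chosen /before /= eqxx /=.
  by rewrite set_nil setU0.
have chE z : z != y -> chosen (clear_set c) (y :: s) z =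
    chosen (clear_set (activate c y)) s z.
  move=> zy; rewrite clear_set_activate // -cat1s chosen_cat_r ?inE //.
  by congr chosen; apply/setP => x; rewrite !inE orbC.
rewrite IH // => [|z zs]; last first.
  by rewrite -chE ?ls ?inE ?zs ?orbT //; apply: contraNneq ys => <-.
rewrite inE; case: (eqVneq v y) => [->|vy] /=; last first.
  by rewrite chE // ffunE (negbTE vy).
rewrite (negbTE ys) ffunE eqxx best_valid_choiceE //.
by rewrite /chosen /before /= eqxx set_nil setU0.
Qed.

Lemma round_live c s : sink_ok c -> activation_order s -> live (clear_set c) s ->
  [/\ sink_ok (round c s), hop (round c s) =1 hop_of (clear_set c) s &
      clear_set (round c s) = reached (clear_set c) s].
Proof.
move=> [selr _] os ls.
have us : uniq s by rewrite (perm_uniq os) enum_uniq.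
have ms v : (v \in s) = (v != r) by rewrite (perm_mem os) mem_enum.
have rs : r \notin s by rewrite ms eqxx.
have hopE : hop (round c s) =1 hop_of (clear_set c) s.
  move=> v; rewrite /hop /round /= sel_control_plane // ms /hop_of.
  by case: eqVneq => [->|//]; rewrite selr.
have clE : clear_set (round c s) = reached (clear_set c) s.
  apply/setP => v; rewrite !inE -(eq_fconnect hopE) fconnect_traject.
  rewrite /clear /round /= ffunE /verified_path /hop /=; case: ifP => //.
  by case: traject.
split=> //; split; first by rewrite /round /= sel_control_plane // ms eqxx.
by rewrite clE inE connect0.
Qed.

End NoFiltering.
End Selection.

Theorem theorem5 (N : network) (c0 : config N)
    (no_filtering : forall v : N, filtering_list v = set0)
    (init_c0 : initial_config c0) :
  exists pi1 pi2 pi3 pi4 : seq N,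
    [/\ activation_order pi1, activation_order pi2,
        activation_order pi3 & activation_order pi4] /\
    forall v : N, reaches_sink c0 [:: pi1; pi2; pi3; pi4] v.
Proof.
have ok0 := initial_sink_ok init_c0.
(* The conditional part is dropped here: the initial clear set need not be closed under [fav] or
   contain [fav_reach]. *)
have [s1 [o1 l1 cl1 F1 _]] := escape_order (proj2 ok0).
have [ok1 _ clr1] := round_live no_filtering ok0 o1 l1.
set c1 := round c0 s1 in ok1 clr1.
rewrite -clr1 in cl1 F1.
have [s2 [o2 l2 cl2 F2 /(_ cl1 F1)[p [up mp chp]]]] := escape_order (proj2 ok1).
have [ok2 _ clr2] := round_live no_filtering ok1 o2 l2.
set c2 := round c1 s2 in ok2 clr2.
rewrite -clr2 in cl2 F2 mp chp.
have [s3 [o3 l3 h3 r3]] := settled_order (proj2 ok2) cl2.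
have [ok3 hop3 clr3] := round_live no_filtering ok2 o3 l3.
set c3 := round c2 s3 in ok3 hop3 clr3.
have c3E v : v \in clear_set c2 -> (v \in clear_set c3) = (v \in fav_reach N).
  by move=> vS; rewrite clr3 !inE (fconnect_in_eq _ cl2 h3 vS).
have F3 : fav_reach N \subset clear_set c3.
  by apply/subsetP => v vF; rewrite c3E // (subsetP F2).
have c3F : clear_set c3 \subset fav_reach N :|: ~: clear_set c2.
  apply/subsetP => v v3; rewrite in_setU in_setC.
  have [v2|_] := boolP (v \in clear_set c2); last by rewrite orbT.
  by rewrite -c3E ?v3.
have dp : [disjoint p & clear_set c3].
  apply/pred0P => v /=; apply/negP => /andP[]; rewrite mp => /setDP[v2 vF].
  by rewrite c3E // (negbTE vF).
have [s4 [o4 l4 sub4]] := rescue_order up dp F3 (chp _ F3 c3F).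
have [ok4 hop4 clr4] := round_live no_filtering ok3 o4 l4.
(* Where packets go in rounds 1 and 2 is irrelevant: these rounds only shape the clear sets. *)
exists s1, s2, s3, s4; split=> // v0 /= v1 _ v2 _ v3 m3 v4 m4.
have v3S : v3 \in clear_set c2.
  apply: packet_move_closed m3 => [x xS|].
    by rewrite hop3 h3 // cl2.
  have [x xS vx] := r3 v2; exists x => //.
  by rewrite (eq_fconnect hop3).
have v3R : v3 \in reached (clear_set c3) s4.
  apply: sub4; rewrite in_setU inE mp in_setD v3S andbT.
  by rewrite orbN.
(* The closed set is now the sink alone. *)
apply/set1P; apply: packet_move_closed m4 => [x /set1P ->|].
  by rewrite hop4 hop_of_sink set11.
exists (sink N); first exact: set11.
by rewrite (eq_fconnect hop4); rewrite inE in v3R.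
Qed.
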